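(* Let $m\in\{2,4,6\}$, $M\ge 2$, $h>0$, $\delta>0$, $\tau\neq 0$ and $\omega_1,\dots,\omega_M\in\mathbb{R}$. Let $(\bm{x}^k,\bm{y}^k)$ and $(\bm{x}^{k+1},\bm{y}^{k+1})$ in $\mathbb{R}^M\times\mathbb{R}^M$ be two configurations, each with pairwise distinct vortex positions, which satisfy the one-step scheme $$\frac{x_i^{k+1}-x_i^k}{\tau}+\frac{h^2}{2\pi}\sum_{j=1,\,j\ne i}^M\omega_j\,\frac{\overline{y_{ij}}}{(r_{ij}^k)^2}\,C_{ij}^{\tau,(m)}=0,\qquad \frac{y_i^{k+1}-y_i^k}{\tau}-\frac{h^2}{2\pi}\sum_{j=1,\,j\ne i}^M\omega_j\,\frac{\overline{x_{ij}}}{(r_{ij}^k)^2}\,C_{ij}^{\tau,(m)}=0,\qquad 1\le i\le M.$$ Then the scheme exactly preserves the linear impulse, the angular impulse and the Hamiltonian: $$\bm{\mathcal{P}}^h(\bm{x}^{k+1},\bm{y}^{k+1})=\bm{\mathcal{P}}^h(\bm{x}^k,\bm{y}^k),\qquad \mathcal{L}^h(\bm{x}^{k+1},\bm{y}^{k+1})=\mathcal{L}^h(\bm{x}^k,\bm{y}^k),\qquad \mathcal{H}^{h,(m)}(\bm{x}^{k+1},\bm{y}^{k+1})=\mathcal{H}^{h,(m)}(\bm{x}^k,\bm{y}^k).$$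
   Context: For a configuration $(\bm{x},\bm{y})\in\mathbb{R}^M\times\mathbb{R}^M$, the $i$-th vortex has position $(x_i,y_i)$; put $x_{ij}=x_i-x_j$, $y_{ij}=y_i-y_j$, $r_{ij}=\sqrt{x_{ij}^2+y_{ij}^2}$. Superscripts $k$, $k+1$ denote evaluation at the configurations $(\bm{x}^k,\bm{y}^k)$, $(\bm{x}^{k+1},\bm{y}^{k+1})$. Write $\overline{x_{ij}}=(x_{ij}^{k+1}+x_{ij}^k)/2$, $\overline{y_{ij}}=(y_{ij}^{k+1}+y_{ij}^k)/2$, $\xi_{ij}^k=(r_{ij}^k/\delta)^2$, $\xi_{ij}^{k+1}=(r_{ij}^{k+1}/\delta)^2$, $\Delta\xi_{ij}=\xi_{ij}^{k+1}-\xi_{ij}^k$. The exponential integral is $E_1(x)=\int_x^\infty \frac{e^{-t}}{t}\,dt$ for $x>0$. Conserved quantities: $$\bm{\mathcal{P}}^h(\bm{x},\bm{y})=\Big(h^2\sum_{i=1}^M\omega_iy_i,\ -h^2\sum_{i=1}^M\omega_ix_i\Big),\qquad \mathcal{L}^h(\bm{x},\bm{y})=-\frac{h^2}{2}\sum_{i=1}^M\omega_i(x_i^2+y_i^2),$$ $$\mathcal{H}^{h,(m)}(\bm{x},\bm{y})=-\frac{h^4}{4\pi}\sum_{1\le i<j\le M}\omega_i\omega_j\Big[\log (r_{ij}^2)+E_1\big(r_{ij}^2/\delta^2\big)+p_m\big(r_{ij}^2/\delta^2\big)\,e^{-r_{ij}^2/\delta^2}\Big],$$ where $p_2(\xi)=0$,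 $p_4(\xi)=-1$, $p_6(\xi)=-\tfrac32+\tfrac12\xi$. Coefficients of the scheme (for $\xi_{ij}^{k+1}\ne\xi_{ij}^k$): $$C_{ij}^{\tau,(2)}=\frac{1}{\frac{\xi_{ij}^{k+1}}{\xi_{ij}^k}-1}\Big[\log\Big|\frac{\xi_{ij}^{k+1}}{\xi_{ij}^k}\Big|+E_1(\xi_{ij}^{k+1})-E_1(\xi_{ij}^k)\Big],$$ $$C_{ij}^{\tau,(4)}=\frac{1}{\frac{\xi_{ij}^{k+1}}{\xi_{ij}^k}-1}\Big[\log\Big|\frac{\xi_{ij}^{k+1}}{\xi_{ij}^k}\Big|+E_1(\xi_{ij}^{k+1})-E_1(\xi_{ij}^k)-e^{-\xi_{ij}^k}\big(e^{-\Delta\xi_{ij}}-1\big)\Big],$$ $$C_{ij}^{\tau,(6)}=\frac{1}{\frac{\xi_{ij}^{k+1}}{\xi_{ij}^k}-1}\Big[\log\Big|\frac{\xi_{ij}^{k+1}}{\xi_{ij}^k}\Big|+E_1(\xi_{ij}^{k+1})-E_1(\xi_{ij}^k)+e^{-\xi_{ij}^k}\big(e^{-\Delta\xi_{ij}}-1\big)\big(-\tfrac32+\tfrac12\xi_{ij}^k\big)\Big]+\tfrac12\,\xi_{ij}^k\,e^{-\xi_{ij}^{k+1}}.$$ When $\xi_{ij}^{k+1}=\xi_{ij}^k$, $C_{ij}^{\tau,(m)}$ is defined by its limiting value $1-Q^{(m)}(\xi_{ij}^k)e^{-\xi_{ij}^k}$, where $Q^{(2)}(r)=1$, $Q^{(4)}(r)=1-r$,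 $Q^{(6)}(r)=1-2r+\tfrac{r^2}{2}$. *)

(* Defs.v *)
From HB Require Import structures.
From mathcomp Require Import all_boot all_order all_algebra.
From mathcomp Require Import all_classical all_reals all_analysis.

Set Implicit Arguments.
Unset Strict Implicit.
Unset Printing Implicit Defensive.

Import Order.TTheory GRing.Theory Num.Theory.
Import numFieldNormedType.Exports.

Local Open Scope ring_scope.

(* A configuration of M vortices is a pair of row vectors x, y : 'rV[R]_M; the
   i-th vortex is at (x 0 i, y 0 i). *)

(* The exponential integral; meaningful for 0 < x only. *)
Definition E1 (R : realType) (x : R) : R :=
  \int[@lebesgue_measure R]_(t in `[x, +oo[) (expR (- t) / t).

Definition vdiff (R : realType) (M : nat) (u : 'rV[R]_M) (i j : 'I_M) : R :=
  u 0 i - u 0 j.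

Definition vdist (R : realType) (M : nat) (x y : 'rV[R]_M) (i j : 'I_M) : R :=
  Num.sqrt (vdiff x i j ^+ 2 + vdiff y i j ^+ 2).

Definition distinct_positions (R : realType) (M : nat) (x y : 'rV[R]_M) : Prop :=
  forall i j : 'I_M, i != j -> (x 0 i, y 0 i) <> (x 0 j, y 0 j).

Definition vdiff_mean (R : realType) (M : nat) (u v : 'rV[R]_M) (i j : 'I_M) : R :=
  (vdiff v i j + vdiff u i j) / 2.

Definition xi_scaled (R : realType) (M : nat) (delta : R) (x y : 'rV[R]_M)
    (i j : 'I_M) : R :=
  (vdist x y i j / delta) ^+ 2.

Definition linear_impulse (R : realType) (M : nat) (h : R) (omega x y : 'rV[R]_M)
    : R * R :=
  (h ^+ 2 * \sum_(i < M) omega 0 i * y 0 i,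
   - (h ^+ 2 * \sum_(i < M) omega 0 i * x 0 i)).

Definition angular_impulse (R : realType) (M : nat) (h : R) (omega x y : 'rV[R]_M)
    : R :=
  - (h ^+ 2 / 2) * \sum_(i < M) omega 0 i * (x 0 i ^+ 2 + y 0 i ^+ 2).

(* In the definitions below the order m ranges over 2, 4, 6; for any other m
   the values are junk. *)

Definition kernel_poly (R : realType) (m : nat) (xi : R) : R :=
  match m with
  | 2%N => 0
  | 4%N => -1
  | 6%N => - (3 / 2) + 1 / 2 * xi
  | _ => 0
  end.

Definition limit_poly (R : realType) (m : nat) (r : R) : R :=
  match m with
  | 2%N => 1
  | 4%N => 1 - r
  | 6%N => 1 - 2 * r + r ^+ 2 / 2
  | _ => 0
  end.

Definition hamiltonian (R : realType) (M : nat) (m : nat) (h delta : R)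
    (omega x y : 'rV[R]_M) : R :=
  - (h ^+ 4 / (4 * pi)) *
    \sum_(i < M) \sum_(j < M | (i < j)%N)
      omega 0 i * omega 0 j *
      (ln (vdist x y i j ^+ 2)
       + E1 (vdist x y i j ^+ 2 / delta ^+ 2)
       + kernel_poly m (vdist x y i j ^+ 2 / delta ^+ 2)
         * expR (- (vdist x y i j ^+ 2 / delta ^+ 2))).

(* The coefficient C^{tau,(m)} as a function of a = xi^k and b = xi^{k+1};
   the value on the diagonal a = b is the limit of the other branch as b
   tends to a. *)
Definition scheme_coef (R : realType) (m : nat) (a b : R) : R :=
  if b == a then 1 - limit_poly m a * expR (- a)
  else match m with
  | 2%N =>
      1 / (b / a - 1) * (ln `|b / a| + E1 b - E1 a)
  | 4%N =>
      1 / (b / a - 1) *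
        (ln `|b / a| + E1 b - E1 a - expR (- a) * (expR (- (b - a)) - 1))
  | 6%N =>
      1 / (b / a - 1) *
        (ln `|b / a| + E1 b - E1 a
         + expR (- a) * (expR (- (b - a)) - 1) * (- (3 / 2) + 1 / 2 * a))
      + 1 / 2 * a * expR (- b)
  | _ => 0
  end.

(* One step of size tau from (x, y) at level k to (x', y') at level k + 1. *)
Definition one_step_scheme (R : realType) (M : nat) (m : nat) (h delta tau : R)
    (omega x y x' y' : 'rV[R]_M) : Prop :=
  forall i : 'I_M,
    (x' 0 i - x 0 i) / tau
      + h ^+ 2 / (2 * pi) *
        (\sum_(j < M | j != i)
           omega 0 j * (vdiff_mean y y' i j / vdist x y i j ^+ 2)
           * scheme_coef m (xi_scaled delta x y i j) (xi_scaled delta x' y' i j))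
      = 0
    /\
    (y' 0 i - y 0 i) / tau
      - h ^+ 2 / (2 * pi) *
        (\sum_(j < M | j != i)
           omega 0 j * (vdiff_mean x x' i j / vdist x y i j ^+ 2)
           * scheme_coef m (xi_scaled delta x y i j) (xi_scaled delta x' y' i j))
      = 0.

(* Main.v *)
(* The pair weights S_ij = C_ij / r_ij^2 are symmetric, so summing the scheme
   against omega_i, resp. against omega_i (x_i^{k+1} + x_i^k, y_i^{k+1} + y_i^k),
   gives antisymmetric double sums, and both impulses are preserved. The
   coefficient C is a discrete gradient: (b / a - 1) C(a, b) is the increment
   from a to b of the pair energy log + E1 + p_m exp(-.), whatever the function
   E1. The Hamiltonian increment is thus a multiple of
   sum_{ij} omega_i omega_j S_ij ((r_ij^{k+1})^2 - (r_ij^k)^2), which the scheme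
   turns into a multiple of sum_i omega_i (- A_i B_i + B_i A_i) = 0 with
   A_i = sum_j omega_j S_ij mean(y_ij) and B_i = sum_j omega_j S_ij mean(x_ij). *)

Require Import Defs.
From HB Require Import structures.
From mathcomp Require Import all_boot all_order all_algebra.
From mathcomp Require Import ring lra.
From mathcomp Require Import all_classical all_reals all_analysis.

Set Implicit Arguments.
Unset Strict Implicit.
Unset Printing Implicit Defensive.

Import Order.TTheory GRing.Theory Num.Theory.
Import numFieldNormedType.Exports.

Local Open Scope ring_scope.

(** Exchanging the two indices shows that the sum is its own opposite, and a numeric domain has no
    2-torsion. *)
Lemma antisym_sum_eq0 (R : numDomainType) (I : finType) (G : I -> I -> R) :
  (forall i j, G j i = - G i j) -> \sum_i \sum_j G i j = 0.
Proof.
move=> antiG; apply/eqP; rewrite -[_ == 0](mulrn_eq0 _ 2) mulr2n.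
rewrite {2}exchange_big -big_split /=; apply/eqP/big1 => i _.
by rewrite -big_split /= big1 // => j _; rewrite antiG addNr.
Qed.

Lemma sym_sum_lt (R : nmodType) (M : nat) (F : 'I_M -> 'I_M -> R) :
  (forall i, F i i = 0) -> (forall i j, F j i = F i j) ->
  \sum_i \sum_j F i j = (\sum_(i < M) \sum_(j < M | (i < j)%N) F i j) *+ 2.
Proof.
move=> F0 symF.
have splitF i : \sum_j F i j =
    \sum_(j < M | (i < j)%N) F i j + \sum_(j < M | (j < i)%N) F i j.
  rewrite (bigID (fun j : 'I_M => (i < j)%N)) /=; congr (_ + _).
  rewrite (bigD1 i) ?ltnn //= F0 add0r; apply: eq_bigl => j.
  by rewrite -leqNgt ltn_neqAle andbC.
rewrite (eq_bigr _ (fun i _ => splitF i)) big_split /= mulr2n; congr (_ + _).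
rewrite (exchange_big_dep predT) //=; apply: eq_bigr => i _.
by apply: eq_bigr => j _; rewrite symF.
Qed.

Section SymmetricPairScheme.

(** The scheme solved for the new positions: [kappa] stands for tau h^2 / (2 pi) and [S i j] for
    C_ij / r_ij^2. *)
Variables (R : realType) (M : nat) (kappa : R).
Variables (omega x y x' y' : 'rV[R]_M) (S : 'I_M -> 'I_M -> R).
Hypothesis symS : forall i j, S j i = S i j.
Hypothesis stepx : forall i, x' 0 i =
  x 0 i - kappa * \sum_j omega 0 j * vdiff_mean y y' i j * S i j.
Hypothesis stepy : forall i, y' 0 i =
  y 0 i + kappa * \sum_j omega 0 j * vdiff_mean x x' i j * S i j.

Lemma vdiff_meanC (u v : 'rV[R]_M) i j :
  vdiff_mean u v j i = - vdiff_mean u v i j.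
Proof. by rewrite /vdiff_mean /vdiff; lra. Qed.

Lemma weighted_mean_sum_eq0 (u v : 'rV[R]_M) :
  \sum_i omega 0 i * \sum_j omega 0 j * vdiff_mean u v i j * S i j = 0.
Proof.
under eq_bigr do rewrite mulr_sumr.
by apply: antisym_sum_eq0 => i j; rewrite symS vdiff_meanC; ring.
Qed.

Lemma linear_momentum_x : \sum_i omega 0 i * x' 0 i = \sum_i omega 0 i * x 0 i.
Proof.
under eq_bigr do rewrite stepx mulrBr mulrCA.
by rewrite sumrB -mulr_sumr weighted_mean_sum_eq0 mulr0 subr0.
Qed.

Lemma linear_momentum_y : \sum_i omega 0 i * y' 0 i = \sum_i omega 0 i * y 0 i.
Proof.
under eq_bigr do rewrite stepy mulrDr mulrCA.
by rewrite big_split /= -mulr_sumr weighted_mean_sum_eq0 mulr0 addr0.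
Qed.

Lemma angular_momentum :
  \sum_i omega 0 i * (x' 0 i ^+ 2 + y' 0 i ^+ 2) =
  \sum_i omega 0 i * (x 0 i ^+ 2 + y 0 i ^+ 2).
Proof.
apply/eqP; rewrite -subr_eq0 -sumrB; apply/eqP.
transitivity (kappa * \sum_i \sum_j omega 0 i * omega 0 j * S i j *
    (vdiff_mean x x' i j * (y' 0 i + y 0 i)
     - vdiff_mean y y' i j * (x' 0 i + x 0 i))); last first.
  (* With X_i = x'_i + x_i and Y_i = y'_i + y_i, the last factor is (X_i Y_j - X_j Y_i) / 2, which
     is antisymmetric. *)
  rewrite antisym_sum_eq0 ?mulr0 // => i j.
  by rewrite symS /vdiff_mean /vdiff; field.
rewrite mulr_sumr; apply: eq_bigr => i _.
transitivity (omega 0 i * ((x' 0 i - x 0 i) * (x' 0 i + x 0 i)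
                           + (y' 0 i - y 0 i) * (y' 0 i + y 0 i))); first by ring.
have -> : x' 0 i - x 0 i =
    - (kappa * \sum_j omega 0 j * vdiff_mean y y' i j * S i j).
  by rewrite {1}stepx addrAC subrr add0r.
have -> : y' 0 i - y 0 i =
    kappa * \sum_j omega 0 j * vdiff_mean x x' i j * S i j.
  by rewrite {1}stepy addrAC subrr add0r.
rewrite mulNr -!mulrA !mulr_suml -mulrN -mulrDr mulrCA; congr (_ * _).
rewrite -sumrN -big_split mulr_sumr /=; apply: eq_bigr => j _; ring.
Qed.

Lemma pair_energy_sum_eq0 :
  \sum_i \sum_j omega 0 i * omega 0 j * S i j *
    ((vdiff x' i j ^+ 2 + vdiff y' i j ^+ 2)
     - (vdiff x i j ^+ 2 + vdiff y i j ^+ 2)) = 0.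
Proof.
(* The increment of r_ij^2 is 2 (dx_i - dx_j) mean(x_ij) plus the same in y. [T i j] keeps the share
   due to the motion of vortex i; as the mean is odd in (i, j), [T j i] is the share of vortex j. *)
pose T i j := 2 * (omega 0 i * omega 0 j * S i j *
  ((x' 0 i - x 0 i) * vdiff_mean x x' i j
   + (y' 0 i - y 0 i) * vdiff_mean y y' i j)).
have T0 : \sum_i \sum_j T i j = 0.
  apply: big1 => i _.
  set A := \sum_j omega 0 j * vdiff_mean y y' i j * S i j.
  set B := \sum_j omega 0 j * vdiff_mean x x' i j * S i j.
  transitivity (2 * omega 0 i * ((x' 0 i - x 0 i) * B + (y' 0 i - y 0 i) * A)).
    rewrite mulrDr /A /B !mulr_sumr -big_split /=.
    by apply: eq_bigr => j _; rewrite /T; ring.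
  by rewrite stepx stepy -/A -/B; ring.
transitivity (\sum_i \sum_j (T i j + T j i)).
  apply: eq_bigr => i _; apply: eq_bigr => j _.
  by rewrite /T symS /vdiff_mean /vdiff; field.
under eq_bigr do rewrite big_split /=.
by rewrite big_split /= [X in _ + X]exchange_big /= T0 addr0.
Qed.

End SymmetricPairScheme.

Section Vortices.

Variables (R : realType) (M : nat).
Implicit Types (x y : 'rV[R]_M) (i j : 'I_M).

Lemma vdistC x y i j : vdist x y j i = vdist x y i j.
Proof.
by rewrite /vdist /vdiff -sqrrN opprB -[X in _ + X]sqrrN opprB.
Qed.

Lemma vdist_sqr x y i j :
  vdist x y i j ^+ 2 = vdiff x i j ^+ 2 + vdiff y i j ^+ 2.
Proof. by rewrite sqr_sqrtr // addr_ge0 ?sqr_ge0. Qed.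

Lemma vdist_sqr_gt0 x y i j :
  distinct_positions x y -> i != j -> 0 < vdist x y i j ^+ 2.
Proof.
move=> dxy /dxy neq; rewrite vdist_sqr lt0r addr_ge0 ?sqr_ge0 // andbT.
rewrite paddr_eq0 ?sqr_ge0 // !sqrf_eq0 !subr_eq0.
by apply/negP => /andP[/eqP xE /eqP yE]; apply: neq; rewrite xE yE.
Qed.

End Vortices.

(** Written in the scaled variable r^2 / delta^2: its logarithm differs from ln (r^2) by the
    constant ln (delta^2), which cancels in increments. *)
Definition pair_energy (R : realType) (m : nat) (a : R) : R :=
  ln a + E1 a + kernel_poly m a * expR (- a).

(** Both sides vanish on the diagonal. For m = 6, the extra term a e^{-b} / 2 contributes (b - a)
    e^{-b} / 2, which turns p_6(a) e^{-b} into p_6(b) e^{-b}. *)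
Lemma scheme_coef_discrete_gradient (R : realType) (m : nat) (a b : R) :
  m \in [:: 2; 4; 6]%N -> 0 < a -> 0 < b ->
  (b / a - 1) * scheme_coef m a b = pair_energy m b - pair_energy m a.
Proof.
move=> hm a0 b0; rewrite /scheme_coef; case: eqVneq => [->|ba].
  by rewrite divff ?gt_eqF // !subrr mul0r.
have an0 : a != 0 by rewrite gt_eqF.
have ban0 : b - a != 0 by rewrite subr_eq0.
have lnE : ln `|b / a| = ln b - ln a.
  by rewrite ger0_norm ?divr_ge0 ?ltW // ln_div // posrE.
have expE : expR (- a) * (expR (- (b - a)) - 1) = expR (- b) - expR (- a).
  by rewrite mulrBr mulr1 -expRD; congr (expR _ - _); ring.
rewrite /pair_energy; move: hm; rewrite !inE => /or3P[] /eqP-> /=.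
- by rewrite lnE; field; rewrite an0 mulN1r ban0.
- by rewrite expE lnE; field; rewrite an0 mulN1r ban0.
- by rewrite expE lnE; field; rewrite an0 mulN1r ban0.
Qed.

Theorem mainTheorem1 (R : realType) (m M : nat) (h delta tau : R)
    (omega x y x' y' : 'rV[R]_M)
    (hm : m \in [:: 2; 4; 6]%N) (hM : (2 <= M)%N)
    (hh : 0 < h) (hdelta : 0 < delta) (htau : tau != 0)
    (hdistinct : distinct_positions x y)
    (hdistinct' : distinct_positions x' y')
    (hscheme : one_step_scheme m h delta tau omega x y x' y') :
  [/\ linear_impulse h omega x' y' = linear_impulse h omega x y,
      angular_impulse h omega x' y' = angular_impulse h omega x y
    & hamiltonian m h delta omega x' y' = hamiltonian m h delta omega x y].
Proof.
pose S i j := scheme_coef m (xi_scaled delta x y i j) (xi_scaled delta x' y' i j)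
              / vdist x y i j ^+ 2.
have symS i j : S j i = S i j by rewrite /S /xi_scaled !(vdistC _ _ i j).
pose kappa := tau * (h ^+ 2 / (2 * pi)).
have mean_diag (u v : 'rV[R]_M) i : vdiff_mean u v i i = 0.
  by rewrite /vdiff_mean /vdiff; lra.
have full_sum (u v : 'rV[R]_M) i :
    \sum_(j < M | j != i) omega 0 j * (vdiff_mean u v i j / vdist x y i j ^+ 2)
      * scheme_coef m (xi_scaled delta x y i j) (xi_scaled delta x' y' i j)
    = \sum_j omega 0 j * vdiff_mean u v i j * S i j.
  (* The added term j = i contains [S i i], a division by r_ii^2 = 0, but its mean factor is
     zero. *)
  rewrite [RHS](bigD1 i) //= mean_diag mulr0 mul0r add0r.
  by apply: eq_bigr => j _; rewrite /S; ring.
have solve_step (a b c A : R) : (b - a) / tau + c * A = 0 ->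
    b = a - tau * c * A.
  move=> /(congr1 (fun z => z * tau)).
  by rewrite mul0r mulrDl divfK // => e; lra.
have stepx i : x' 0 i =
    x 0 i - kappa * \sum_j omega 0 j * vdiff_mean y y' i j * S i j.
  by have [+ _] := hscheme i; rewrite full_sum => /solve_step.
have stepy i : y' 0 i =
    y 0 i + kappa * \sum_j omega 0 j * vdiff_mean x x' i j * S i j.
  have [_] := hscheme i; rewrite full_sum -mulrN => /solve_step ->.
  by rewrite mulrN opprK.
split.
- by rewrite /linear_impulse (linear_momentum_x symS stepx)
             (linear_momentum_y symS stepy).
- by rewrite /angular_impulse (angular_momentum symS stepx stepy).
have d2_gt0 : 0 < delta ^+ 2 by rewrite exprn_gt0.
pose F i j := omega 0 i * omega 0 j * S i j *
    ((vdiff x' i j ^+ 2 + vdiff y' i j ^+ 2)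
     - (vdiff x i j ^+ 2 + vdiff y i j ^+ 2)).
have F_sum0 : \sum_(i < M) \sum_(j < M | (i < j)%N) F i j = 0.
  have := pair_energy_sum_eq0 symS stepx stepy.
  rewrite -/F (@sym_sum_lt _ _ F); last 2 first.
  - by move=> i; rewrite /F /vdiff !subrr; ring.
  - by move=> i j; rewrite /F symS /vdiff; ring.
  by move/eqP; rewrite mulrn_eq0 => /eqP.
rewrite /hamiltonian; congr (_ * _); apply/eqP; rewrite -subr_eq0 -sumrB.
(* Writing 0 as the sum of [F] over i < j lets the Hamiltonian increment be compared pair by
   pair. *)
apply/eqP; rewrite -[RHS]F_sum0; apply: eq_bigr => i _; rewrite -sumrB; apply: eq_bigr => j ij.
have nij : i != j by rewrite -(inj_eq val_inj) ltn_eqF.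
have r_gt0 := vdist_sqr_gt0 hdistinct nij.
have r'_gt0 := vdist_sqr_gt0 hdistinct' nij.
rewrite -mulrBr /F -!vdist_sqr -[RHS]mulrA; congr (_ * _).
have := scheme_coef_discrete_gradient hm
          (divr_gt0 r_gt0 d2_gt0) (divr_gt0 r'_gt0 d2_gt0).
rewrite /pair_energy !ln_div ?posrE // /S /xi_scaled !expr_div_n => gradE.
(* In the ratio delta^2 cancels, so (b / a - 1) C = (r'^2 - r^2) C / r^2, which is [S i j] times the
   increment of r_ij^2. *)
transitivity ((vdist x' y' i j ^+ 2 / delta ^+ 2
               / (vdist x y i j ^+ 2 / delta ^+ 2) - 1)
  * scheme_coef m (vdist x y i j ^+ 2 / delta ^+ 2)
                  (vdist x' y' i j ^+ 2 / delta ^+ 2)).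
  by rewrite gradE; ring.
move: r_gt0 d2_gt0; set C := scheme_coef _ _ _.
move=> /lt0r_neq0; rewrite sqrf_eq0 => rn0 _; field.
by rewrite rn0 gt_eqF.
Qed.
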